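(* Assume that $\mathbf b\notin\mathbf H$. Let $W$ be the subspace of $\mathbb V$ with $\mathbf H=\{\langle u\rangle: u\in W,\ u\ne\theta\}$, and let $\xi_0$ be the restriction of $\xi$ to $W$ (so $\xi_0$ determines $\perp_{\mathbf H}$). Then $$\mathrm{Aut}(\mathfrak B_1)=\{\varphi\in\Gamma L(W):\ \varphi\text{ preserves }\perp_{\mathbf H}\}.$$
   Context: Setting. $\mathfrak F$ is a perfect field of characteristic $2$, $\mathbb V$ is a vector space over $\mathfrak F$ of finite dimension $n\ge2$ with zero vector $\theta$, and $\mathfrak P$ is the projective space of $\mathbb V$ (points are $\langle u\rangle$ with $u\ne\theta$). Lines of $\mathfrak P$ have at least $6$ points. $\xi$ is a nondegenerate symmetric bilinear form on $\mathbb V$ which is not alternating, and $\langle u\rangle\perp\langle v\rangle$ means $\xi(u,v)=0$. The set $\mathbf H$ of selfconjugate points ($p\perp p$) is then a hyperplane of $\mathfrak P$, and its pole is a point $\mathbf b$ (so $\mathbf b^\perp=\mathbf H$). $\perp_{\mathbf H}$ is the restriction of $\perp$ to $\mathbf H$. A subspace $U$ of $\mathfrak P$ is regular if $U\cap U^\perp=\emptyset$, where $U^\perp=\{p: p\perp q\text{ for all }q\in U\}$; regular points are exactly the points not on $\mathbf H$. $\mathfrak B_1$ is the point-line structure with points the regular points different from $\mathbf b$, lines the regular lines not contained in $\mathbf H$, and natural incidence. Identification. Let $\mathfrak A$ be the affine space obtained from $\mathfrak P$ by deleting $\mathbf H$. Since $\mathbf b\notin\mathbf H$, write $\mathbf b=\langle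 e_0\rangle$ and identify the affine point $\langle w+e_0\rangle$ with the vector $w\in W$; thus $\mathfrak A$ is the affine space over $W$ with origin $\mathbf b$, and the point set of $\mathfrak B_1$ is $W\setminus\{\theta\}$. $\Gamma L(W)$ is the group of semilinear bijections of $W$, acting on the points of $\mathfrak B_1$ via this identification and on $\mathbf H$ by $\langle u\rangle\mapsto\langle\varphi(u)\rangle$; $\varphi$ preserves $\perp_{\mathbf H}$ if this action preserves the relation $\perp_{\mathbf H}$. *)

(* Defs.v *)
From HB Require Import structures.
From mathcomp Require Import all_boot all_order all_algebra.
From mathcomp Require Import boolp classical_sets.

Set Implicit Arguments.
Unset Strict Implicit.
Unset Printing Implicit Defensive.

Import GRing.Theory.
Local Open Scope ring_scope.
Local Open Scope classical_set_scope.

(* Point-line structures.  An automorphism is recorded by its action on points;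
   in a structure whose lines are determined by their points this action
   determines the action on lines. *)

Record incidence_structure := IncidenceStructure {
  points : Type;
  lines : Type;
  incident : points -> lines -> Prop
}.

Definition automorphisms (S : incidence_structure) :
    set (points S -> points S) :=
  [set f | bijective f /\
     exists g : lines S -> lines S,
       bijective g /\ forall p L, incident p L <-> incident (f p) (g L)].
Arguments automorphisms : clear implicits.

(* Subspaces of the projective space of V are represented by the subspaces of V;
   incidence is inclusion, and disjointness is having zero intersection. *)

Section Projective.
Context {F : fieldType} {V : vectType F}.
Implicit Types (p q L U W : {vspace V}).

Definition is_point p : bool := \dim p == 1%N.
Definition is_line L : bool := \dim L == 2%N.

Definition lines_have_at_least (k : nat) : Prop :=
  forall L, is_line L ->
    exists s : seq {vspace V},
      [/\ uniq s, size s = k & {in s, forall p, is_point p && (p <= L)%VS}].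

Definition points_of W : set {vspace V} :=
  [set <[u]>%VS | u in [set u : V | u \in W /\ u != 0]].

Variable xi : {symmetric V}.

(* On points <[u]> and <[v]> this is xi u v == 0, see lemma orthov11. *)
Definition perp p q : bool := (p <= orthov xi q)%VS.

Definition polar q : set {vspace V} := [set p | is_point p /\ perp p q].

Definition selfconjugate : set {vspace V} := [set p | is_point p /\ perp p p].

Definition regular U : bool := (U :&: orthov xi U == 0)%VS.

Definition B1_points (b : {vspace V}) : set {vspace V} :=
  [set p | [/\ is_point p, regular p & p <> b]].

Definition B1_lines : set {vspace V} :=
  [set L | [/\ is_line L, regular L &
     ~ (forall p, is_point p -> (p <= L)%VS -> selfconjugate p)]].

Definition B1 (b : {vspace V}) : incidence_structure :=
  IncidenceStructure
    (fun (p : B1_points b) (L : B1_lines) => (\val p <= \val L)%VS : Prop).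

End Projective.

Arguments lines_have_at_least {F} V k.

Section SemilinearBijections.
Context {F : fieldType}.

Record GammaL (U : vectType F) := MkGammaL {
  GammaL_fun :> U -> U;
  GammaL_bij : bijective GammaL_fun;
  GammaL_semilinear : exists sigma : {rmorphism F -> F},
    bijective sigma /\ GRing.linear_for (sigma \; *:%R) GammaL_fun
}.

Lemma GammaL_neq0 (U : vectType F) (phi : GammaL U) (w : U) :
  w != 0 -> phi w != 0.
Proof.
have [sigma [_ lin]] := GammaL_semilinear phi.
have phi0 : phi 0 = 0.
  by have := lin (-1) 0 0; rewrite /= scaler0 addr0 rmorphN1 scaleN1r addNr.
by apply: contraNneq => phiw0; apply/eqP/(bij_inj (GammaL_bij phi)); rewrite phi0.
Qed.

Definition nonzero (U : vectType F) : Type := {w : U | w != 0}.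

Definition GammaL_nonzero (U : vectType F) (phi : GammaL U) (w : nonzero U) :
    nonzero U :=
  exist _ (phi (sval w)) (GammaL_neq0 phi (svalP w)).

(* The action of phi on the points of H, <[u]> |-> <[phi u]>, preserves perp. *)
Definition preserves_perpH {V : vectType F} (xi : {symmetric V})
    (W : {vspace V}) (phi : GammaL (subvs_of W)) : Prop :=
  forall u v : subvs_of W, u != 0 -> v != 0 ->
    perp xi <[vsval u]>%VS <[vsval v]>%VS <->
    perp xi <[vsval (phi u)]>%VS <[vsval (phi v)]>%VS.

End SemilinearBijections.

(* The identification of the nonzero vectors w of W with the points
   <[w + e0]> of B1, and the resulting action of GammaL(W) on these points. *)

Section Identification.
Context {F : fieldType} {V : vectType F} (xi : {symmetric V}).
Context (b W : {vspace V}) (e0 : V).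
Hypothesis b_pole : polar xi b = selfconjugate xi.
Hypothesis b_notin_H : ~ selfconjugate xi b.
Hypothesis W_H : selfconjugate xi = points_of W.
Hypothesis b_pt : is_point b.
Hypothesis b_e0 : b = <[e0]>%VS.

Lemma is_pointE (u : V) : is_point <[u]>%VS = (u != 0).
Proof. by rewrite /is_point dim_vline eqb1. Qed.

Lemma point_gen (p : {vspace V}) : is_point p -> exists2 u, u != 0 & p = <[u]>%VS.
Proof.
move=> /eqP dp; have p0 : p != 0%VS by rewrite -dimv_eq0 dp.
exists (vpick p); first by rewrite vpick0.
by apply/esym/eqP; rewrite eqEdim -memvE memv_pick dim_vline vpick0 p0 dp.
Qed.

Lemma e0_neq0 : e0 != 0. Proof. by rewrite -is_pointE -b_e0. Qed.

Lemma xi_e0 : xi e0 e0 != 0.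
Proof.
apply/negP => e00; apply: b_notin_H; split=> //.
by rewrite b_e0 /perp orthov11.
Qed.

Lemma memW (u : V) : (u \in W) = (xi u e0 == 0).
Proof.
have [->|u0] := eqVneq u 0; first by rewrite mem0v linear0l eqxx.
have uE : polar xi b <[u]>%VS <-> xi u e0 == 0.
  by rewrite /polar /= is_pointE b_e0 /perp orthov11; split=> [[]|].
apply/idP/idP => [uW|/uE].
  by apply/uE; rewrite b_pole W_H; exists u.
by rewrite b_pole W_H => -[v [vW v0] /eqP]; rewrite eqEsubv => /andP[_ /subvP]
  /(_ u (memv_line u)) /vlineP[k ->]; rewrite memvZ.
Qed.

Lemma W_isotropic (u : V) : u \in W -> xi u u = 0.
Proof.
have [->|u0 uW] := eqVneq u 0; first by rewrite linear0l.
have : selfconjugate xi <[u]>%VS by rewrite W_H; exists u.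
by case=> _; rewrite /perp orthov11 => /eqP.
Qed.

Lemma regular_line (u : V) : regular xi <[u]>%VS = (u == 0) || (xi u u != 0).
Proof.
rewrite /regular; have [->|u0] /= := eqVneq u 0; first by rewrite cap0v eqxx.
apply/eqP/idP => [cap0|xiu].
  apply: contraNneq u0 => xiu; rewrite -memv0 -cap0 memv_cap memv_line.
  by rewrite mem_orthov1 xiu eqxx.
apply/eqP; rewrite -subv0; apply/subvP => x; rewrite memv_cap => /andP[].
move=> /vlineP[k ->]; rewrite mem_orthov1 linearZl_LR /= mulf_eq0 (negPf xiu) orbF.
by move=> /eqP ->; rewrite scale0r mem0v.
Qed.

Lemma xi_e0_affine (w : V) : w \in W -> xi (w + e0) e0 = xi e0 e0.
Proof. by rewrite memW => /eqP w0; rewrite linearDl /= w0 add0r. Qed.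

Lemma affine_neq0 (w : V) : w \in W -> w + e0 != 0.
Proof.
move=> wW; apply: contraNneq xi_e0 => we0.
by rewrite -(xi_e0_affine wW) we0 linear0l.
Qed.

Lemma affine_inj (w w' : V) : w \in W -> w' \in W ->
  <[w + e0]>%VS = <[w' + e0]>%VS -> w = w'.
Proof.
move=> wW w'W ww'.
have /vlineP[k kE] : w + e0 \in <[w' + e0]>%VS by rewrite -ww' memv_line.
have := congr1 (xi ^~ e0) kE; rewrite /= linearZl_LR /= !xi_e0_affine // => /eqP.
rewrite -{1}[xi e0 e0]mul1r (inj_eq (mulIf xi_e0)) => /eqP k1.
by move: kE; rewrite -k1 scale1r => /addIr.
Qed.

Lemma affine_point_B1 (w : subvs_of W) :
  w != 0 -> B1_points xi b <[vsval w + e0]>%VS.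
Proof.
move=> w0; have wW := subvsP w; split; first by rewrite is_pointE affine_neq0.
- rewrite regular_line; apply/orP; right.
  have we0 : xi (vsval w) e0 = 0 by apply/eqP; rewrite -memW.
  have e0w : xi e0 (vsval w) = 0 by rewrite hermC /= we0 mulr0.
  rewrite linearDr /= (xi_e0_affine wW) linearDl /= (W_isotropic wW) e0w !add0r.
  exact: xi_e0.
- rewrite b_e0 -[X in <[X]>%VS = _]addrC -{2}[e0]add0r => /esym.
  rewrite [e0 + _]addrC => /(affine_inj (mem0v W) wW) w0'.
  by move: w0; rewrite -(inj_eq val_inj) /= -w0' eqxx.
Qed.

Definition affine_point (w : nonzero (subvs_of W)) : points (B1 xi b) :=
  SigSub (mem_set (affine_point_B1 (svalP w))).

Lemma affine_point_surj (p : points (B1 xi b)) : exists w, affine_point w = p.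
Proof.
case: p => p pP; have [p_pt p_reg p_b] := set_mem pP.
have [u u0 pE] := point_gen p_pt.
have xiu : xi u u != 0 by move: p_reg; rewrite pE regular_line (negPf u0).
have ue0 : xi u e0 != 0.
  by apply: contraNneq xiu => ue0; rewrite W_isotropic // memW ue0.
pose k := xi e0 e0 / xi u e0; have k0 : k != 0 by rewrite mulf_neq0 ?invr_eq0 ?xi_e0.
pose w := k *: u - e0.
have wW : w \in W.
  by rewrite memW /w linearBl /= linearZl_LR /= divfK // subrr.
have lineE : <[w + e0]>%VS = <[u]>%VS.
  rewrite /w subrK; apply/eqP.
  by rewrite eqEdim -memvE memvZ ?memv_line //= !dim_vline scaler_eq0 (negPf k0).
have w0 : Subvs wW != 0.
  apply/eqP => /(congr1 val) /= w0; apply: p_b.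
  by rewrite pE -lineE w0 add0r b_e0.
by exists (exist (fun x : subvs_of W => x != 0) _ w0); apply: val_inj; rewrite /= lineE pE.
Qed.

Lemma affine_point_inj : injective affine_point.
Proof.
move=> w w' /(congr1 val) /= /affine_inj ww'.
by apply: val_inj; apply: val_inj; apply: ww'; exact: subvsP.
Qed.

Definition affine_vector (p : points (B1 xi b)) : nonzero (subvs_of W) :=
  sval (cid (affine_point_surj p)).

Lemma affine_vectorK : cancel affine_vector affine_point.
Proof. by move=> p; rewrite /affine_vector; case: cid. Qed.

Lemma affine_pointK : cancel affine_point affine_vector.
Proof. by move=> w; apply: affine_point_inj; rewrite affine_vectorK. Qed.

Definition GammaL_action (phi : GammaL (subvs_of W)) :
    points (B1 xi b) -> points (B1 xi b) :=
  affine_point \o GammaL_nonzero phi \o affine_vector.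

End Identification.

(* Main.v *)
Require Import Defs.
From HB Require Import structures.
From mathcomp Require Import all_boot all_order all_algebra.
From mathcomp Require Import boolp classical_sets.

Set Implicit Arguments.
Unset Strict Implicit.

Import GRing.Theory.
Local Open Scope ring_scope.
Local Open Scope classical_set_scope.

(** The form om = xi|W is alternating and, since V is the orthogonal sum of
    <[e0]> and W, nondegenerate. A line of the projective space meeting W in
    <[d]> and containing the affine point w + e0 is regular iff om w d != 0
    ([affine_line_B1], [B1_line_affine]). So B1 is the geometry whose points
    are the nonzero vectors of W and whose lines are the affine lines through
    pairs u, v with om u v != 0; in particular two distinct points are collinear
    iff they are not orthogonal.

    A semilinear bijection of W that preserves orthogonality therefore permutes
    these lines ([action_automorphism]).

    Conversely, an automorphism f, extended by f 0 = 0, preserves orthogonality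
    and the affine lines through nonorthogonal pairs, and this forces
    semilinearity ([line_preserving_semilinear]). Indeed f preserves double
    perps, so it preserves the lines through 0 and the hyperbolic planes. If
    om p q != 0, the line p + F q is one of the lines of B1 and all its points
    are nonorthogonal to q; its image lies in the plane spanned by f p and f q,
    with no point orthogonal to f q, so it is f p + F (f q). Exchanging p and q
    and intersecting the two images gives f (p + q) = f p + f q
    ([image_add_nperp]). An orthogonal sum u + v is written
    (u + r) + (v - r), with r chosen so that every sum that has to be evaluated
    is of the previous kind; such an r exists as soon as the field contains a
    scalar other than 0 and -1, which the size of the projective lines
    guarantees ([image_add], [exists_scalar_of_long_lines]). Finally f scales each
    line through 0 by a function of the scalar which, by additivity, is the same
    for nonorthogonal vectors, hence for all vectors, and is a field automorphism. *)

(** * Symplectic forms *)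

Section SymplecticForms.
Context {F : fieldType} {U : lmodType F}.

Definition symplectic (om : U -> U -> F) : Prop :=
  [/\ forall w, GRing.linear_for *%R (om ^~ w),
      forall w, GRing.linear_for *%R (om w),
      forall u, om u u = 0 &
      forall u, u != 0 -> exists v, om u v != 0].

Context (om : U -> U -> F) (om_symp : symplectic om).

Lemma om0l u : om 0 u = 0.
Proof.
by case: om_symp => linl _ _ _; have := linl u (-1) 0 0; rewrite scaler0 addr0 mulN1r addNr.
Qed.

Lemma omDl u v w : om (u + v) w = om u w + om v w.
Proof. by case: om_symp => linl _ _ _; have := linl w 1 u v; rewrite scale1r mul1r. Qed.

Lemma omZl a u w : om (a *: u) w = a * om u w.
Proof. by case: om_symp => linl _ _ _; have := linl w a u 0; rewrite om0l !addr0. Qed.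

Lemma omDr u v w : om w (u + v) = om w u + om w v.
Proof. by case: om_symp => _ linr _ _; have := linr w 1 u v; rewrite scale1r mul1r. Qed.

Lemma om_alt u : om u u = 0.
Proof. by case: om_symp. Qed.

Lemma om_nondeg u : u != 0 -> exists v, om u v != 0.
Proof. by case: om_symp => _ _ _; apply. Qed.

Lemma omC u v : om v u = - om u v.
Proof.
have := om_alt (u + v); rewrite omDl !omDr !om_alt add0r addr0.
by rewrite addrC => /eqP; rewrite addr_eq0 => /eqP.
Qed.

Lemma omZr a u w : om w (a *: u) = a * om w u.
Proof. by rewrite omC omZl omC mulrN opprK. Qed.

Lemma omNl u w : om (- u) w = - om u w.
Proof. by rewrite -scaleN1r omZl mulN1r. Qed.

Lemma omNr u w : om w (- u) = - om w u.
Proof. by rewrite -scaleN1r omZr mulN1r. Qed.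

Definition omE := (omDl, omDr, omNl, omNr, omZl, omZr, om_alt).

Lemma om_neq0l u v : om u v != 0 -> u != 0.
Proof. by apply: contraNneq => ->; rewrite om0l. Qed.

Lemma om_neq0C u v : (om u v != 0) = (om v u != 0).
Proof. by rewrite omC oppr_eq0. Qed.

(** Projecting along the plane of u and v leaves a vector orthogonal to both u
    and v; for x in the double perp this remainder is orthogonal to everything. *)
Lemma hyperbolic_double_perp u v x : om u v != 0 ->
    (forall y, om y u = 0 -> om y v = 0 -> om y x = 0) ->
  exists a b, x = a *: u + b *: v.
Proof.
move=> h_neq0 xperp; set h := om u v in h_neq0.
pose proj z := (om z v / h) *: u + (om u z / h) *: v.
have projl z : om (z - proj z) u = 0.
  by rewrite /proj !omE mulr0 add0r (omC u v) (omC u z) -/h mulrN divfK // subrr.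
have projr z : om (z - proj z) v = 0 by rewrite /proj !omE -/h mulr0 addr0 divfK // subrr.
have perp_proj w z : om w u = 0 -> om w v = 0 -> om w (proj z) = 0.
  by move=> wu wv; rewrite /proj omDr !omZr wu wv !mulr0 addr0.
exists (om x v / h), (om u x / h); rewrite -/(proj x).
apply/eqP; rewrite -subr_eq0; apply/negP => /negP /om_nondeg[y /negP[]].
have -> : om (x - proj x) y = om (x - proj x) (y - proj y).
  by rewrite -[y in LHS](subrK (proj y)) (omDr _ (proj y)) (perp_proj _ y) ?addr0.
by rewrite omC omDr omNr xperp // perp_proj // !oppr0 addr0 oppr0.
Qed.

(** The double perp of u lies in that of any hyperbolic pair u, v, and
    orthogonality to u itself kills the coefficient of v. *)
Lemma point_double_perp u x : u != 0 ->
    (forall y, om y u = 0 -> om y x = 0) -> exists a, x = a *: u.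
Proof.
move=> /om_nondeg[v uv] xperp.
have [//|a [b xE]] := @hyperbolic_double_perp u v x uv.
  by move=> y yu _; exact: xperp.
have := xperp u (om_alt u); rewrite xE !omE mulr0 add0r => /eqP.
rewrite mulf_eq0 (negPf uv) orbF => /eqP b0.
by exists a; rewrite b0 scale0r addr0.
Qed.

Lemma common_nonorthogonal u v : u != 0 -> v != 0 ->
  exists r, om u r != 0 /\ om v r != 0.
Proof.
move=> /om_nondeg[r ur] /om_nondeg[s vs].
have [vr|vr] := eqVneq (om v r) 0; last by exists r.
have [us|us] := eqVneq (om u s) 0; last by exists s.
by exists (r + s); rewrite !omDr vr us addr0 add0r.
Qed.

(** Independence makes the functionals om u and om v independent: by
    [point_double_perp] each has a vector in its kernel on which the other does
    not vanish. *)
Lemma independent_values u v a : u != 0 -> v != 0 ->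
    (forall k, v <> k *: u) ->
  exists r, om u r = 1 /\ om v r = a.
Proof.
move=> u0 v0 vu.
have sep x z : x != 0 -> (forall k, z <> k *: x) -> exists y, om x y = 0 /\ om z y != 0.
  move=> x0 zx; apply: contrapT => /forallNP sepN.
  have [|k zE] := point_double_perp (u := x) (x := z) x0; last exact: zx zE.
  move=> y yx; apply/eqP; rewrite omC oppr_eq0; apply/negPn/negP => zy.
  by apply: (sepN y); split=> //; rewrite omC yx oppr0.
have uv k : u <> k *: v.
  move=> uE; have k0 : k != 0 by apply: contraNneq u0 => k0; rewrite uE k0 scale0r.
  by apply: (vu k^-1); rewrite uE scalerA mulVf // scale1r.
have [y [uy vy]] := sep u v u0 vu; have [z [vz uz]] := sep v u v0 uv.
exists ((om u z)^-1 *: z + (a / om v y) *: y); rewrite !omE uy vz !mulr0 addr0 add0r.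
by rewrite mulVf // divfK.
Qed.

End SymplecticForms.

(** * Line-preserving bijections of a symplectic space *)

Section LinePreservingBijections.
Context {F : fieldType} {U : lmodType F} {om : U -> U -> F} {f : U -> U}.

Definition on_line (p q x : U) : Prop := exists s : F, x = p + s *: (q - p).

Hypotheses (om_symp : symplectic om) (f_bij : bijective f) (f0 : f 0 = 0).
Hypothesis f_perp : forall u v, om (f u) (f v) = 0 <-> om u v = 0.
Hypothesis f_line : forall p q x, om p q != 0 ->
  on_line (f p) (f q) (f x) <-> on_line p q x.

Let omE := omE om_symp.

Lemma image_surj y : exists x, y = f x.
Proof. by case: f_bij => g _ gK; exists (g y). Qed.

Lemma image_neq0 u : u != 0 -> f u != 0.
Proof. by apply: contraNneq; rewrite -{1}f0 => /(bij_inj f_bij) ->. Qed.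

Lemma image_nperp u v : (om (f u) (f v) != 0) = (om u v != 0).
Proof.
congr (~~ _); apply/eqP/eqP => uv; exact/f_perp.
Qed.

(** A hyperbolic plane is its own double perp, a notion that f preserves. *)
Lemma image_plane p q a b : om p q != 0 ->
  exists a' b', f (a *: p + b *: q) = a' *: f p + b' *: f q.
Proof.
rewrite -image_nperp => /(hyperbolic_double_perp om_symp); apply => y.
have [x ->] := image_surj y => /f_perp xp /f_perp xq.
by apply/f_perp; rewrite !omE xp xq !mulr0 addr0.
Qed.

Lemma image_point p a : exists a', f (a *: p) = a' *: f p.
Proof.
have [->|/image_neq0 p0] := eqVneq p 0; first by exists 0; rewrite scaler0 f0 scaler0.
apply: (point_double_perp om_symp p0) => y.
by have [x ->] := image_surj y => /f_perp xp; apply/f_perp; rewrite !omE xp mulr0.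
Qed.

Lemma preimage_point p a' : p != 0 -> exists a, f (a *: p) = a' *: f p.
Proof.
move=> p0; have [x xE] := image_surj (a' *: f p).
have [|a xa] := point_double_perp om_symp (x := x) p0; last by exists a; rewrite -xa.
by move=> y /f_perp yp; apply/f_perp; rewrite -xE !omE yp mulr0.
Qed.

(** The line p + F q consists of vectors nonorthogonal to q. If its image were
    not parallel to f q, it would, in the plane of f p and f q, meet the line
    through 0 and f q, in a point orthogonal to f q. *)
Lemma image_parallel p q : om p q != 0 -> exists c, f (p + q) = f p + c *: f q.
Proof.
move=> pq; have [a [b]] := image_plane 1 1 pq; rewrite !scale1r => fpq.
have [a1|a1] := eqVneq a 1; first by exists b; rewrite fpq a1 scale1r.
have {}a1 : 1 - a != 0 by rewrite subr_eq0 eq_sym.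
(* At this parameter the line through f p and f (p + q) meets F (f q). *)
pose t := (1 - a)^-1.
have [x xE] := image_surj (f p + t *: (f (p + q) - f p)).
have [s] : on_line p (p + q) x.
  apply/(@f_line p (p + q)); first by rewrite !omE add0r.
  by exists t.
rewrite addrAC subrr add0r => xs.
have xq : om (f x) (f q) = 0.
  suff -> : f x = (t * b) *: f q by rewrite !omE mulr0.
  rewrite -xE fpq addrAC -[X in _ - X]scale1r -scalerBl scalerDr !scalerA addrA.
  rewrite -[X in X + _ + _]scale1r -scalerDl.
  have -> : 1 + t * (a - 1) = 0 by rewrite -opprB mulrN mulVf // subrr.
  by rewrite scale0r add0r.
by move/f_perp/eqP: xq; rewrite xs !omE mulr0 addr0 (negPf pq).
Qed.

(** The vector p + q is the meet of the lines p + F q and q + F p. *)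
Lemma image_add_nperp p q : om p q != 0 -> f (p + q) = f p + f q.
Proof.
move=> pq; have [c fpq] := image_parallel pq.
have [c'] : exists c', f (q + p) = f q + c' *: f p.
  by apply: image_parallel; rewrite om_neq0C.
rewrite addrC fpq => /(congr1 (om (f p))) /eqP; rewrite !omE mulr0 add0r addr0.
rewrite -subr_eq0 -{2}[om (f p) (f q)]mul1r -mulrBl mulf_eq0 subr_eq0.
rewrite -[om (f p) _ == 0]negbK image_nperp pq orbF => /eqP ->.
by rewrite scale1r.
Qed.

(** Evaluate f (- p + (p + r)), where p and r are nonorthogonal. *)
Lemma image_opp p : f (- p) = - f p.
Proof.
have [->|p0] := eqVneq p 0; first by rewrite oppr0 f0 oppr0.
have [r pr] := om_nondeg om_symp p0.
have : f (- p + (p + r)) = f (- p) + (f p + f r).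
  by rewrite image_add_nperp ?image_add_nperp // !omE ?oppr0 ?add0r ?oppr_eq0.
rewrite addKr -{1}[f r]add0r addrA => /addIr/esym/eqP.
by rewrite addr_eq0 => /eqP.
Qed.

Hypothesis exists_scalar : exists a : F, a != 0 /\ a != -1.

Lemma image_add u v : f (u + v) = f u + f v.
Proof.
have [->|u0] := eqVneq u 0; first by rewrite f0 !add0r.
have [->|v0] := eqVneq v 0; first by rewrite f0 !addr0.
have [uv|] := eqVneq (om u v) 0; last exact: image_add_nperp.
(* Independent orthogonal vectors: take om u r = 1 and om v r = a; then
   om (u + r) (v - r) = - (1 + a) and om v (- r) = - a must not vanish. *)
have [[k vE]|vNu] := pselect (exists k, v = k *: u); last first.
  have [a [a0 a1]] := exists_scalar.
  have [k vk|r [ur vr]] := independent_values om_symp a u0 v0.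
    by apply: vNu; exists k.
  have -> : u + v = (u + r) + (v - r) by rewrite addrACA subrr addr0.
  rewrite image_add_nperp; last first.
    rewrite !omE uv (omC om_symp v r) vr ur oppr0 addr0 add0r -opprD oppr_eq0.
    by rewrite addrC addr_eq0.
  rewrite image_add_nperp ?ur ?oner_eq0 // image_add_nperp; last by rewrite !omE vr oppr_eq0.
  by rewrite image_opp addrACA subrr addr0.
have [k1|k1] := eqVneq k (-1).
  by rewrite vE k1 scaleN1r subrr f0 image_opp subrr.
have k0 : k != 0 by apply: contraNneq v0 => k0; rewrite vE k0 scale0r.
(* The remaining case, v = k *: u, compares two ways of evaluating f (u + v + r). *)
have [r ur] := om_nondeg om_symp u0.
have vr : om v r != 0 by rewrite vE !omE mulf_neq0.
apply: (@addIr _ (f r)); rewrite -addrA -!image_add_nperp //.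
- by rewrite addrA.
- by rewrite !omE uv add0r.
- by rewrite vE !omE -[X in X + _]mul1r -mulrDl mulf_neq0 // addrC addr_eq0.
Qed.

(** Compare the coefficients of f p and f q in f (t *: (p + q)). *)
Lemma same_scale_nperp t p q a b : om p q != 0 ->
  f (t *: p) = a *: f p -> f (t *: q) = b *: f q -> a = b.
Proof.
move=> pq fa fb; have [c] := image_point (p + q) t.
rewrite scalerDr !image_add fa fb scalerDr => fc; move: pq; rewrite -image_nperp => pq.
have := congr1 (om (f p)) fc; rewrite !omE !mulr0 !add0r => /(mulIf pq) ->.
have := congr1 (om ^~ (f q)) fc; rewrite /= !omE !mulr0 !addr0.
by move=> /(mulIf pq) ->.
Qed.

Lemma same_scale t p q a b : p != 0 -> q != 0 ->
  f (t *: p) = a *: f p -> f (t *: q) = b *: f q -> a = b.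
Proof.
move=> p0 q0 fa fb; have [r [pr qr]] := common_nonorthogonal om_symp p0 q0.
have [c fc] := image_point r t.
by rewrite (same_scale_nperp pr fa fc) (same_scale_nperp qr fb fc).
Qed.

(** A variant of the fundamental theorem of affine geometry: only the affine
    lines off the origin that lie in a hyperbolic plane are assumed to be
    preserved, and orthogonality makes up for the others. *)
Theorem line_preserving_semilinear :
  exists sigma : {rmorphism F -> F},
    bijective sigma /\ GRing.linear_for (sigma \; *:%R) f.
Proof.
have [p0|/forallNP U0] := pselect (exists p : U, p != 0); last first.
  have U1 (u : U) : u = 0 by apply/eqP/negPn/negP/U0.
  exists idfun; split; first by exists idfun.
  by move=> a u v; rewrite [LHS]U1 [RHS]U1.
case: p0 => p p0; have fp0 := image_neq0 p0.
pose s t := sval (cid (image_point p t)).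
have sp t : f (t *: p) = s t *: f p by rewrite /s; case: cid.
have sE t u : f (t *: u) = s t *: f u.
  have [->|u0] := eqVneq u 0; first by rewrite !scaler0 f0 scaler0.
  by have [a fa] := image_point u t; rewrite fa (same_scale p0 u0 (sp t) fa).
have fpI : injective ( *:%R ^~ (f p)).
  move=> a b /= /eqP; rewrite -subr_eq0 -scalerBl scaler_eq0 (negPf fp0) orbF.
  by rewrite subr_eq0 => /eqP.
have s_add : zmod_morphism s.
  by move=> a b; apply: fpI; rewrite /= -sE !scalerBl image_add image_opp !sE.
have s_mul : monoid_morphism s.
  split=> [|a b]; apply: fpI; rewrite /= -sE ?scale1r //.
  by rewrite -!scalerA !sE.
pose addM := GRing.isZmodMorphism.Build F F s s_add.
pose mulM := GRing.isMonoidMorphism.Build F F s s_mul.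
pose sigma : {rmorphism F -> F} := HB.pack s addM mulM.
exists sigma; split=> [|a u v] /=; last by rewrite image_add sE.
have s_surj b : exists a, s a = b.
  have [a fa] := preimage_point b p0; exists a.
  by apply: fpI; rewrite /= -sE.
exists (fun b => sval (cid (s_surj b))) => [a|b]; last by rewrite /=; case: cid.
by case: cid => c /= sc; apply: (fmorph_inj sigma).
Qed.

End LinePreservingBijections.

(** The pairing of two points of the line is the difference of their parameters
    times om v1 v2, so that any two distinct points serve to describe it. *)
Lemma on_line_through {F : fieldType} {U : lmodType F} {om : U -> U -> F}
    (om_symp : symplectic om) (v1 v2 p q : U) :
    om v1 v2 != 0 -> on_line v1 v2 p -> on_line v1 v2 q -> p <> q ->
  om p q != 0 /\ forall x, on_line p q x <-> on_line v1 v2 x.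
Proof.
move=> v12 [s ->] [t ->] /eqP; set d := v2 - v1.
rewrite (inj_eq (addrI _)) -subr_eq0 -scalerBl scaler_eq0 negb_or subr_eq0 eq_sym.
move=> /andP[st d0]; have {}st : t - s != 0 by rewrite subr_eq0.
have qp : v1 + t *: d - (v1 + s *: d) = (t - s) *: d.
  by rewrite opprD addrACA subrr add0r -scalerBl.
split=> [|x].
  have -> : v1 + t *: d = (v1 + s *: d) + (t - s) *: d.
    by rewrite -addrA -scalerDl [s + _]addrC subrK.
  have v1d : om v1 d != 0 by rewrite /d !(omE om_symp) subr0.
  rewrite (omDr om_symp) (om_alt om_symp) add0r (omZr om_symp) (omDl om_symp).
  by rewrite (omZl om_symp) (om_alt om_symp) mulr0 addr0 mulf_neq0.
rewrite /on_line qp -/d; split=> [[r ->]|[r ->]].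
  by exists (s + r * (t - s)); rewrite scalerA -addrA scalerDl.
by exists ((r - s) / (t - s)); rewrite scalerA divfK // -addrA -scalerDl [s + _]addrC subrK.
Qed.

Lemma on_line_neq0 {F : fieldType} {U : lmodType F} {om : U -> U -> F}
    (om_symp : symplectic om) (u v : U) : om u v != 0 -> ~ on_line u v 0.
Proof.
move=> uv [s u0]; have := congr1 (om u) u0.
rewrite (omC om_symp 0) (om0l om_symp) oppr0 !(omE om_symp) subr0 add0r.
move/esym/eqP; rewrite mulf_eq0 (negPf uv) orbF => /eqP s0.
move: u0; rewrite s0 scale0r addr0 => u0.
by move: uv; rewrite -u0 (om0l om_symp) eqxx.
Qed.

(** * Incidence structures and projective lines *)

(** When lines are determined by their points, the two choices of matching lines
    are mutually inverse. *)
Lemma automorphism_of_lines (S : incidence_structure) (f : points S -> points S) :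
    (forall L L' : lines S, (forall p, incident p L <-> incident p L') -> L = L') ->
    bijective f ->
    (forall L : lines S, exists L', forall p, incident p L <-> incident (f p) L') ->
    (forall L' : lines S, exists L, forall p, incident p L <-> incident (f p) L') ->
  automorphisms S f.
Proof.
move=> line_ext f_bij /choice[g gP] /choice[h hP]; split=> //.
have [k fK kK] := f_bij.
exists g; split; last by move=> p L; exact: gP.
exists h => L; apply: line_ext => p; first by rewrite hP -gP.
by rewrite -[p]kK -gP hP.
Qed.

Section ProjectiveLines.
Context {F : fieldType} {V : vectType F}.

Lemma dim_two_lines (u v : V) : u != 0 -> v \notin <[u]>%VS ->
  \dim (<[u]> + <[v]>) = 2%N.
Proof.
move=> u0 vu; apply/eqP; rewrite eqn_leq; apply/andP; split.
  by rewrite (leq_trans (dimv_add_leqif _ _)) // !dim_vline u0; case: (v != 0).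
have <- : \dim <[u]>%VS = 1%N by rewrite dim_vline u0.
rewrite (ltn_leqif (dimv_leqif_sup (addvSl _ _))).
apply: contra vu => /subvP; apply; apply: (subvP (addvSr _ _)); exact: memv_line.
Qed.

Lemma exists_outside_line (X : {vspace V}) (u : V) : (1 < \dim X)%N ->
  exists2 v, v \in X & v \notin <[u]>%VS.
Proof.
move=> X1; have [XS|/subvPn[v]] := boolP (X <= <[u]>)%VS; last by exists v.
by have := leq_trans X1 (dimvS XS); rewrite dim_vline ltnNge leq_b1.
Qed.

(** With no scalars besides 0 and -1, a projective line spanned by <[u]> and
    <[v]> has only the points <[u]>, <[v]> and <[u + v]>. *)
Lemma exists_scalar_of_long_lines k : (1 < \dim {:V})%N -> (3 < k)%N ->
  lines_have_at_least V k -> exists a : F, a != 0 /\ a != -1.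
Proof.
move=> V1 k3 linesk; apply: contrapT => /forallNP scal.
have scalP (a : F) : a = 0 \/ a = -1.
  have [->|a0] := eqVneq a 0; first by left.
  by have [->|a1] := eqVneq a (-1); [right | have [] := scal a].
have [u _ u0] := @exists_outside_line fullv 0 V1.
have {}u0 : u != 0 by apply: contraNneq u0 => ->; rewrite mem0v.
have [v _ vu] := @exists_outside_line fullv u V1.
have [|s [s_uniq s_size sP]] := linesk (<[u]> + <[v]>)%VS.
  by rewrite /is_line dim_two_lines.
have : (size s <= size [:: <[u]>%VS; <[v]>%VS; <[u + v]>%VS ])%N; last first.
  by rewrite s_size leqNgt k3.
apply: uniq_leq_size => // p /sP /andP[/point_gen[x x0 ->]].
rewrite -memvE => /memv_addP[_ /vlineP[a ->] [_ /vlineP[c ->] xE]].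
have lineN (y : V) : <[- y]>%VS = <[y]>%VS.
  by apply/eqP; rewrite eqEsubv -!memvE memvN memv_line -[X in X \in _]opprK memvN memv_line.
move: x0; rewrite xE !inE.
case: (scalP a) => ->; case: (scalP c) => ->;
  rewrite ?scale0r ?scaleN1r ?add0r ?addr0 ?eqxx // -?opprD lineN eqxx ?orbT //.
Qed.

End ProjectiveLines.

(** * Extension of maps by zero *)

Section ExtensionByZero.
Context {F : fieldType} {U : vectType F}.

Definition extend0 (h : nonzero U -> nonzero U) (u : U) : U :=
  oapp (fun w => sval (h w)) 0 (insub u).

Lemma extend0_0 h : extend0 h 0 = 0.
Proof. by rewrite /extend0 insubF ?eqxx. Qed.

Lemma extend0E h (w : nonzero U) : extend0 h (sval w) = sval (h w).
Proof. by rewrite /extend0 (valK w). Qed.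

Lemma extend0K h k : cancel h k -> cancel (extend0 h) (extend0 k).
Proof.
move=> hK u; have [->|u0] := eqVneq u 0; first by rewrite !extend0_0.
by rewrite -[u]/(sval (exist _ u u0 : nonzero U)) !extend0E hK.
Qed.

Lemma extend0_bij h : bijective h -> bijective (extend0 h).
Proof. by case=> k hK kK; exists (extend0 k); exact: extend0K. Qed.

End ExtensionByZero.

(** * The affine model of B1 *)

Lemma GammaL0 {F : fieldType} {U : vectType F} (phi : GammaL U) : phi 0 = 0.
Proof.
have [sigma [_ lin]] := GammaL_semilinear phi.
by have := lin (-1) 0 0; rewrite /= scaler0 addr0 rmorphN1 scaleN1r addNr.
Qed.

Section AffineModel.
Context {F : fieldType} {V : vectType F} {xi : {symmetric V}} {b W : {vspace V}} {e0 : V}.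
Hypotheses (b_pole : polar xi b = selfconjugate xi) (b_notin_H : ~ selfconjugate xi b).
Hypotheses (W_H : selfconjugate xi = points_of W) (b_pt : is_point b).
Hypothesis b_e0 : b = <[e0]>%VS.
Hypothesis xi_nondegenerate : nondegenerate xi.

Definition W_form (u v : subvs_of W) : F := xi (vsval u) (vsval v).

Let e00 : xi e0 e0 != 0 := xi_e0 b_notin_H b_pt b_e0.
Let W_perp u : (u \in W) = (xi u e0 == 0) := memW b_pole W_H b_e0 u.
Let W_iso u : u \in W -> xi u u = 0 := @W_isotropic _ _ _ _ W_H u.

Lemma W_e0 (w : subvs_of W) : xi (vsval w) e0 = 0.
Proof. by apply/eqP; rewrite -W_perp subvsP. Qed.

Lemma xiC u v : xi u v = xi v u.
Proof. by rewrite hermC /= expr0 mul1r. Qed.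

(** Nondegeneracy passes to W because any v can be corrected by a multiple of e0,
    which is orthogonal to W, so as to lie in W. *)
Lemma W_form_symplectic : symplectic W_form.
Proof.
split=> [w a u v|w a u v|u|u u0]; rewrite /W_form.
- by rewrite linearP linearPl.
- by rewrite /= linearPr.
- exact: W_iso (subvsP u).
have : vsval u \notin orthov xi fullv by rewrite (eqP xi_nondegenerate) memv0.
case/mem_orthovPn => v _ uv; pose k := xi v e0 / xi e0 e0.
have vW : v - k *: e0 \in W by rewrite W_perp linearBl /= linearZl_LR /= divfK // subrr.
by exists (Subvs vW); rewrite /= linearBr /= linearZr_LR /= W_e0 mulr0 subr0.
Qed.

(** The projective closure of the affine line through w1 and w2. *)
Definition affine_line (w1 w2 : subvs_of W) : {vspace V} :=
  (<[vsval w1 + e0]> + <[vsval w2 - vsval w1]>)%VS.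

(** Pairing with e0, which vanishes on W, shows that w + e0 takes the generator
    w1 + e0 with coefficient 1. *)
Lemma affine_lineP w1 w2 w :
  (<[vsval w + e0]> <= affine_line w1 w2)%VS <-> on_line w1 w2 w.
Proof.
rewrite -memvE; split=> [/memv_addP[_ /vlineP[r ->] [_ /vlineP[s ->] wE]]|[s ->]].
  exists s; apply: val_inj => /=.
  have := congr1 (xi ^~ e0) wE; rewrite /= !linearDl /= !linearZl_LR /= linearDl linearBl /=.
  rewrite !W_e0 subrr mulr0 addr0 !add0r -{1}[xi e0 e0]mul1r => /(mulIf e00) r1.
  by apply: (@addIr _ e0); rewrite wE -r1 scale1r addrAC.
rewrite /= addrAC; apply: memv_add; first exact: memv_line.
by rewrite memvZ // memv_line.
Qed.

Lemma affine_line_dim w1 w2 : w1 != w2 -> is_line (affine_line w1 w2).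
Proof.
move=> w12; rewrite /is_line dim_two_lines //.
  exact: (affine_neq0 b_pole b_notin_H W_H b_pt b_e0 (subvsP w1)).
apply: contra w12 => /vlineP[k w12].
have := congr1 (xi ^~ e0) w12; rewrite /= linearBl linearZl_LR linearDl /=.
rewrite !W_e0 subrr add0r => /esym/eqP; rewrite mulf_eq0 (negPf e00) orbF => /eqP k0.
by move/eqP: w12; rewrite k0 scale0r subr_eq0 eq_sym -(inj_eq val_inj).
Qed.

Lemma xi_affine (w1 w2 : subvs_of W) :
  xi (vsval w1 + e0) (vsval w2 + e0) = W_form w1 w2 + xi e0 e0.
Proof.
by rewrite linearDl !linearDr /= (xiC e0 (vsval w2)) !W_e0 addr0 add0r.
Qed.

(** In the basis w1 + e0, w2 - w1 the Gram matrix has determinant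
    - (W_form w1 w2) ^+ 2, as the direction w2 - w1 is isotropic. *)
Lemma affine_line_B1 w1 w2 : W_form w1 w2 != 0 -> B1_lines xi (affine_line w1 w2).
Proof.
move=> w12; split.
- apply: affine_line_dim; apply: contraNneq w12 => ->.
  by rewrite (om_alt W_form_symplectic).
- rewrite /regular -subv0; apply/subvP => x; rewrite memv_cap.
  case/andP => /memv_addP[_ /vlineP[r ->] [_ /vlineP[s ->] ->]] /mem_orthovP xperp.
  set p := vsval w1 + e0; set d := vsval w2 - vsval w1.
  have pd : xi p d = W_form w1 w2.
    rewrite /p /d linearDl !linearBr /= !(xiC e0) !W_e0 subr0 addr0.
    by rewrite W_iso ?subvsP // subr0.
  have dd : xi d d = 0 by apply: W_iso; rewrite memvB ?subvsP.
  have := xperp d (subvP (addvSr _ _) _ (memv_line d)).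
  rewrite linearDl !linearZl_LR /= pd dd mulr0 addr0 => /eqP.
  rewrite mulf_eq0 (negPf w12) orbF => /eqP r0.
  move: xperp; rewrite r0 scale0r add0r => xperp.
  have := xperp p (subvP (addvSl _ _) _ (memv_line p)).
  rewrite linearZl_LR /= xiC pd => /eqP; rewrite mulf_eq0 (negPf w12) orbF => /eqP ->.
  by rewrite scale0r mem0v.
- move=> /(_ <[vsval w1 + e0]>%VS) [].
  + by rewrite is_pointE (affine_neq0 b_pole b_notin_H W_H b_pt b_e0) ?subvsP.
  + exact: addvSl.
  move=> _; rewrite /perp orthov11 xi_affine (om_alt W_form_symplectic) add0r.
  exact/negP.
Qed.

(** A point of L outside W is normalised to w1 + e0, and the direction d spans the
    intersection of L with W. If d were orthogonal to w1, it would lie in the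
    radical of L. *)
Lemma B1_line_affine L : B1_lines xi L ->
  exists w1 w2, W_form w1 w2 != 0 /\ L = affine_line w1 w2.
Proof.
case=> L_line L_reg /existsNP[_ /not_implyP[/point_gen[u u0 ->] /not_implyP[]]].
rewrite -memvE => uL uNself.
have ue0 : xi u e0 != 0.
  rewrite -W_perp; apply/negP => uW; apply: uNself; split; first by rewrite is_pointE.
  by rewrite /perp orthov11 W_iso.
have [v vL vu] : exists2 v, v \in L & v \notin <[u]>%VS.
  by apply: exists_outside_line; rewrite (eqP L_line).
have w1W : (xi e0 e0 / xi u e0) *: u - e0 \in W.
  by rewrite W_perp linearBl /= linearZl_LR /= divfK // subrr.
have dW : v - (xi v e0 / xi u e0) *: u \in W.
  by rewrite W_perp linearBl /= linearZl_LR /= divfK // subrr.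
pose w1 := Subvs w1W; pose d := Subvs dW.
have w1L : vsval w1 + e0 \in L by rewrite /= subrK memvZ.
have dL : vsval d \in L by rewrite /= memvB // memvZ.
have d0 : vsval d != 0.
  apply: contra vu; rewrite /= subr_eq0 => /eqP ->; exact/memvZ/memv_line.
clearbody w1 d.
have w12 : w1 != w1 + d.
  by rewrite -subr_eq0 opprD addrA subrr add0r oppr_eq0 -(inj_eq val_inj).
have L_eq : L = affine_line w1 (w1 + d).
  apply/esym/eqP; rewrite eqEdim (eqP L_line) (eqP (affine_line_dim w12)) leqnn andbT.
  by rewrite subv_add -!memvE w1L /= addrAC subrr add0r dL.
exists w1, (w1 + d); split=> //.
rewrite (omDr W_form_symplectic) (om_alt W_form_symplectic) add0r.
apply: contra d0 => /eqP w1d; rewrite -memv0 -(eqP L_reg) memv_cap dL.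
apply/mem_orthovP => x; rewrite L_eq => /memv_addP[_ /vlineP[r ->] [_ /vlineP[s ->] ->]].
have -> : vsval (w1 + d) - vsval w1 = vsval d by rewrite /= addrC addKr.
rewrite xiC linearDl !linearZl_LR /= linearDl /= (xiC e0) -/(W_form w1 d) w1d.
by rewrite (W_e0 d) (W_iso (subvsP d)) addr0 !mulr0 addr0.
Qed.

Let A := affine_point b_pole b_notin_H W_H b_pt b_e0.

Lemma incident_affine_line (L : lines (B1 xi b)) : exists w1 w2,
  W_form w1 w2 != 0 /\ forall w, incident (A w) L <-> on_line w1 w2 (sval w).
Proof.
have [w1 [w2 [w12 LE]]] := B1_line_affine (set_mem (valP L)).
exists w1, w2; split=> // w; rewrite -affine_lineP -LE; exact: iff_refl.
Qed.

Lemma exists_incident_line w1 w2 : W_form w1 w2 != 0 ->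
  exists L : lines (B1 xi b), forall w, incident (A w) L <-> on_line w1 w2 (sval w).
Proof.
move=> w12; exists (SigSub (mem_set (affine_line_B1 w12))) => w.
by rewrite -affine_lineP.
Qed.

(** A line of B1 contains two affine points, w1 and w2, which span it. *)
Lemma B1_line_ext (L L' : lines (B1 xi b)) :
  (forall p, incident p L <-> incident p L') -> L = L'.
Proof.
move=> LL'; apply: val_inj.
have [w1 [w2 [w12 LE]]] := B1_line_affine (set_mem (valP L)).
have [L'_line _ _] := set_mem (valP L').
have w1_neq0 : w1 != 0 := om_neq0l W_form_symplectic w12.
have w2_neq0 : w2 != 0.
  by apply: (om_neq0l W_form_symplectic (v := w1)); rewrite om_neq0C //; exact: W_form_symplectic.
have inL' (w : nonzero (subvs_of W)) : on_line w1 w2 (sval w) ->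
    vsval (sval w) + e0 \in val L'.
  by move=> w_on; rewrite memvE; apply/(LL' (A w)); rewrite /= LE; apply/affine_lineP.
have w1L' : vsval w1 + e0 \in val L'.
  by apply: (inL' (exist _ w1 w1_neq0)); exists 0; rewrite scale0r addr0.
have w2L' : vsval w2 + e0 \in val L'.
  by apply: (inL' (exist _ w2 w2_neq0)); exists 1; rewrite scale1r addrC subrK.
have w1w2 : w1 != w2.
  by apply: contraNneq w12 => ->; rewrite (om_alt W_form_symplectic).
apply/eqP; rewrite LE eqEdim (eqP (affine_line_dim w1w2)) (eqP L'_line) leqnn andbT.
rewrite subv_add -!memvE w1L' /=.
have -> : vsval w2 - vsval w1 = (vsval w2 + e0) - (vsval w1 + e0).
  by rewrite opprD addrACA subrr addr0.
exact: memvB.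
Qed.

Lemma collinear_affine_points (u v : nonzero (subvs_of W)) (L : lines (B1 xi b)) :
    u <> v -> incident (A u) L -> incident (A v) L ->
  W_form (sval u) (sval v) != 0 /\
  forall w, incident (A w) L <-> on_line (sval u) (sval v) (sval w).
Proof.
move=> uv; have [w1 [w2 [w12 LP]]] := incident_affine_line L.
move=> /LP u_on /LP v_on; have [|uv0 on_uv] :=
  on_line_through W_form_symplectic w12 u_on v_on; first by move/val_inj.
by split=> // w; rewrite LP on_uv.
Qed.

Let Av := affine_vector b_pole b_notin_H W_H b_pt b_e0.
Let AK : cancel A Av := affine_pointK b_pole b_notin_H W_H b_pt b_e0.
Let AvK : cancel Av A := affine_vectorK b_pole b_notin_H W_H b_pt b_e0.
Let act := GammaL_action b_pole b_notin_H W_H b_pt b_e0.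

Lemma preserves_perpHE (phi : GammaL (subvs_of W)) : preserves_perpH xi phi <->
  forall u v, W_form (phi u) (phi v) = 0 <-> W_form u v = 0.
Proof.
have perpE u v : perp xi <[vsval u]>%VS <[vsval v]>%VS <-> W_form u v = 0.
  by rewrite /perp orthov11; split=> /eqP.
have symp := W_form_symplectic.
split=> [pres u v|pres u v _ _]; last by rewrite !perpE pres.
have [->|u0] := eqVneq u 0; first by rewrite GammaL0 !(om0l symp).
have [->|v0] := eqVneq v 0; first by rewrite GammaL0 !(omC symp 0) !(om0l symp).
by have := pres u v u0 v0; rewrite !perpE => pres_uv; apply: iff_sym.
Qed.

(** Lines correspond because they are described by nonorthogonal pairs, and both
    phi and its inverse preserve these. *)
Lemma action_automorphism (phi : GammaL (subvs_of W)) :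
  preserves_perpH xi phi -> automorphisms (B1 xi b) (act phi).
Proof.
move=> /preserves_perpHE pres.
have [sigma [sigma_bij phi_lin]] := GammaL_semilinear phi.
have phi_bij := GammaL_bij phi.
have phi_line u v x : on_line (phi u) (phi v) (phi x) <-> on_line u v x.
  have lineE s : phi (u + s *: (v - u)) = phi u + sigma s *: (phi v - phi u).
    have sub : phi (v - u) = phi v - phi u.
      have := phi_lin (-1) u v; rewrite /= rmorphN1 !scaleN1r => phi_sub.
      by rewrite addrC phi_sub addrC.
    by rewrite addrC phi_lin sub addrC.
  split=> [[t phix]|[s ->]]; last by exists (sigma s).
  have [tau tauK sigmaK] := sigma_bij; exists (tau t).
  by apply: (bij_inj phi_bij); rewrite lineE sigmaK.
have act_A w : act phi (A w) = A (GammaL_nonzero phi w).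
  by rewrite /act /GammaL_action /= -/A -/Av AK.
have line_match (L L' : lines (B1 xi b)) u v :
    (forall w, incident (A w) L <-> on_line u v (sval w)) ->
    (forall w, incident (A w) L' <-> on_line (phi u) (phi v) (sval w)) ->
  forall p, incident p L <-> incident (act phi p) L'.
  by move=> LP L'P p; rewrite -[p]AvK act_A LP L'P phi_line.
apply: automorphism_of_lines.
- exact: B1_line_ext.
- have nz_bij : bijective (GammaL_nonzero phi).
    have [psi phiK psiK] := phi_bij.
    have psi_neq0 w : w != 0 -> psi w != 0.
      by apply: contraNneq => psiw0; rewrite -[w]psiK psiw0 GammaL0.
    exists (fun w : nonzero _ => exist _ (psi (sval w)) (psi_neq0 _ (svalP w))) => w;
      by apply: val_inj; rewrite /= ?phiK ?psiK.
  by apply: bij_comp; [apply: bij_comp => //; exists Av | exists A].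
- move=> L; have [u [v [uv LP]]] := incident_affine_line L.
  have [|L' L'P] := @exists_incident_line (phi u) (phi v).
    by apply: contra_neq uv => /pres.
  by exists L'; exact: line_match LP L'P.
- move=> L'; have [u' [v' [uv' L'P]]] := incident_affine_line L'.
  have [psi _ psiK] := phi_bij.
  have [|L LP] := @exists_incident_line (psi u') (psi v').
    by apply: contra_neq uv' => /pres; rewrite !psiK.
  by exists L; apply: (line_match _ _ _ _ LP); rewrite !psiK.
Qed.

Hypothesis exists_scalar : exists a : F, a != 0 /\ a != -1.

(** Nonorthogonal pairs are the pairs on a common line, so an automorphism,
    extended by zero, satisfies the hypotheses of [line_preserving_semilinear]. *)
Lemma automorphism_action (f : points (B1 xi b) -> points (B1 xi b)) :
  automorphisms (B1 xi b) f -> exists2 phi, preserves_perpH xi phi & act phi = f.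
Proof.
move=> [[f' fK f'K] [g [[g' gK g'K] fg]]].
have symp := W_form_symplectic.
pose h w := Av (f (A w)); pose h' w := Av (f' (A w)).
have hK : cancel h h' by move=> w; rewrite /h /h' AvK fK AK.
have h'K : cancel h' h by move=> w; rewrite /h /h' AvK f'K AK.
have hg w L : incident (A (h w)) (g L) <-> incident (A w) L.
  rewrite /h AvK; exact: iff_sym (fg _ _).
have h_neq u v : sval u <> sval v -> h u <> h v.
  by move=> uv /(can_inj hK) huv; apply: uv; rewrite huv.
have ext_bij : bijective (extend0 h) by apply: extend0_bij; exists h'.
have image_line u v : W_form u v != 0 ->
    W_form (extend0 h u) (extend0 h v) != 0 /\
    forall x, on_line (extend0 h u) (extend0 h v) (extend0 h x) <-> on_line u v x.
  move=> uv; have u0 := om_neq0l symp uv.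
  have v0 : v != 0 by apply: (om_neq0l symp (v := u)); rewrite om_neq0C.
  have [L LP] := exists_incident_line uv.
  pose u1 : nonzero _ := exist _ u u0; pose v1 : nonzero _ := exist _ v v0.
  have Lu : incident (A u1) L by apply/LP; exists 0; rewrite scale0r addr0.
  have Lv : incident (A v1) L by apply/LP; exists 1; rewrite scale1r addrC subrK.
  have uNv : u <> v by move=> uv1; move: uv; rewrite uv1 (om_alt symp) eqxx.
  have [] := @collinear_affine_points (h u1) (h v1) (g L).
  - exact: h_neq.
  - exact/hg.
  - exact/hg.
  rewrite -!extend0E /= => huv hLP; split=> // x.
  have [->|x0] := eqVneq x 0.
    by rewrite extend0_0; split=> [/(on_line_neq0 symp huv)|/(on_line_neq0 symp uv)].
  pose x1 : nonzero _ := exist _ x x0.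
  rewrite -[x]/(sval x1) extend0E.
  exact: iff_trans (iff_sym (hLP (h x1))) (iff_trans (hg x1 L) (LP x1)).
have image_perp u v : W_form (extend0 h u) (extend0 h v) = 0 <-> W_form u v = 0.
  split=> [huv0|uv0]; first by apply/eqP/negPn/negP => /image_line[]; rewrite huv0 eqxx.
  apply/eqP/negPn/negP => huv.
  have uNv : u <> v by move=> uv; move: huv; rewrite uv (om_alt symp) eqxx.
  have u0 : u != 0 by apply: contraNneq huv => ->; rewrite extend0_0 (om0l symp).
  have v0 : v != 0.
    by apply: contraNneq huv => ->; rewrite extend0_0 (omC symp) (om0l symp) oppr0.
  pose u1 : nonzero _ := exist _ u u0; pose v1 : nonzero _ := exist _ v v0.
  have [L' L'P] := exists_incident_line huv.
  have L'u : incident (A u1) (g' L').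
    apply/hg; rewrite g'K; apply/L'P; rewrite -extend0E.
    by exists 0; rewrite scale0r addr0.
  have L'v : incident (A v1) (g' L').
    apply/hg; rewrite g'K; apply/L'P; rewrite -extend0E.
    by exists 1; rewrite scale1r addrC subrK.
  have [|] := collinear_affine_points _ L'u L'v; first by move=> /(congr1 sval).
  by rewrite /= uv0 eqxx.
have h_semilinear := line_preserving_semilinear symp ext_bij (extend0_0 h) image_perp
  (fun p q x pq => (image_line p q pq).2 x) exists_scalar.
exists (MkGammaL ext_bij h_semilinear); first exact/preserves_perpHE.
apply/funext => p; rewrite /act /GammaL_action /= -/A -/Av.
have -> : GammaL_nonzero (MkGammaL ext_bij h_semilinear) (Av p) = h (Av p).
  by apply: val_inj; rewrite /= extend0E.
by rewrite /h !AvK.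
Qed.

End AffineModel.

(** * The automorphism group *)

Theorem proposition3p22
    (F : fieldType) (charF2 : 2%N \in [pchar F])
    (perfectF : forall x : F, exists y : F, pFrobenius_aut charF2 y = x)
    (V : vectType F) (n : nat) (dimV : \dim {:V} = n) (n_ge2 : (2 <= n)%N)
    (lines_ge6 : lines_have_at_least V 6)
    (xi : {symmetric V})
    (xi_nondegenerate : nondegenerate xi)
    (xi_not_alternating : ~ (forall u : V, xi u u = 0))
    (b : {vspace V}) (b_pt : is_point b)
    (b_pole : polar xi b = selfconjugate xi)
    (b_notin_H : ~ selfconjugate xi b)
    (W : {vspace V}) (W_H : selfconjugate xi = points_of W)
    (e0 : V) (b_e0 : b = <[e0]>%VS) :
  automorphisms (B1 xi b) =
  [set GammaL_action b_pole b_notin_H W_H b_pt b_e0 phi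
     | phi in [set phi : GammaL (subvs_of W) | preserves_perpH xi phi]].
Proof.
have exists_scalar : exists a : F, a != 0 /\ a != -1.
  by apply: exists_scalar_of_long_lines lines_ge6; rewrite ?dimV.
apply/seteqP; split=> [f f_aut|_ [phi phi_perp <-]].
  have [phi phi_perp phiE] := automorphism_action b_pole b_notin_H W_H b_pt b_e0
    xi_nondegenerate exists_scalar f_aut.
  by exists phi.
exact: action_automorphism.
Qed.
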